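(* For every integer $k \ge 5$, $\mathrm{sdim}(GP(4k,2)) = 5k$.
   Context: Let $n,m$ be integers with $n \ge 3$ and $1 \le m < n/2$. The generalized Petersen graph $GP(n,m)$ is the simple undirected graph with vertex set $V = \{u_i, v_i \mid 0 \le i \le n-1\}$ ($2n$ vertices) and edge set $\{\{u_i,u_{i+1}\}, \{u_i,v_i\}, \{v_i,v_{i+m}\} \mid 0 \le i \le n-1\}$, where vertex indices are taken modulo $n$. Let $G$ be a simple connected undirected graph and let $d$ be its shortest-path distance. A vertex $w$ strongly resolves two vertices $u$ and $v$ if $u$ belongs to a shortest $v$–$w$ path or $v$ belongs to a shortest $u$–$w$ path (equivalently, $d(v,w) = d(v,u) + d(u,w)$ or $d(u,w) = d(u,v) + d(v,w)$). A vertex set $S$ of $G$ is a strong resolving set of $G$ if every two distinct vertices of $G$ are strongly resolved by some vertex of $S$. The strong metric dimension $\mathrm{sdim}(G)$ is the minimum cardinality of a strong resolving set of $G$. *)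

(* Defs.v *)
From mathcomp Require Import all_boot.

Set Implicit Arguments.
Unset Strict Implicit.
Unset Printing Implicit Defensive.

(* A simple undirected graph is given by its adjacency relation, a symmetric
   irreflexive relation on a finite type. *)
Section StrongMetricDimension.

Variables (T : finType) (e : rel T).

(* In a connected graph distances are smaller than #|T|; two vertices in
   different components get the junk value #|T|. *)
Definition gdist (x y : T) : nat :=
  find (fun l => [exists p : l.-tuple T, path e x p && (last x p == y)])
       (iota 0 #|T|).

(* z belongs to some shortest x-y path, the path being x :: p *)
Definition on_shortest_path (z x y : T) : bool :=
  [exists p : (gdist x y).-tuple T,
    [&& path e x p, last x p == y & z \in x :: p]].

Definition strongly_resolves (w u v : T) : bool :=
  on_shortest_path u v w || on_shortest_path v u w.

Definition strong_resolving_set (S : {set T}) : bool :=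
  [forall u, forall v, (u != v) ==> [exists w in S, strongly_resolves w u v]].

(* The starting value [set: T] of the minimization is a strong resolving set
   whenever the graph is connected. *)
Definition sdim : nat :=
  #|[arg min_(S < [set: T] | strong_resolving_set S) #|S|]|.

End StrongMetricDimension.

(* Generalized Petersen graph, meant for 3 <= n and 1 <= m < n/2;
   inl i is the outer vertex u_i and inr i the inner vertex v_i. *)
Definition GP (n m : nat) : rel ('I_n + 'I_n) := fun x y =>
  match x, y with
  | inl i, inl j => (j == i + 1 %[mod n]) || (i == j + 1 %[mod n])
  | inl i, inr j => i == j
  | inr i, inl j => i == j
  | inr i, inr j => (j == i + m %[mod n]) || (i == j + m %[mod n])
  end.

(* Main.v *)
Require Import Defs.
From mathcomp Require Import all_boot.
From mathcomp Require Import zify.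

(** Call two vertices x, y mutually maximally distant (mmd) when no neighbour
    of y is farther from x than y, and no neighbour of x is farther from y
    than x.  A vertex that strongly resolves such a pair lies at the end of a
    geodesic prolonging the pair, so it must be x or y; conversely every pair
    u, v lies on a geodesic between mmd vertices, either of which strongly
    resolves u and v.  Hence strong resolving sets are exactly the vertex covers
    of the graph of mmd pairs ([strong_resolving_setP]), that is, complements
    of its independent sets, and the claim is that the largest independent set
    has 8k - 5k = 3k vertices.

    Put n = 4k and let c be the cyclic distance of the indices.  As n is even, c
    has the parity of the difference of the indices, and a geodesic uses outer
    edges only over short distances or to correct the parity.  The distances are
    min(c, uphalf c + 2) between outer vertices, uphalf c + 1 between an outer
    and an inner one, and c/2 + 3 (c mod 2) between inner ones ([GP_gdist]).
    Reading off the mmd pairs, u_i and u_j form one when c = 2k or when c is odd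
    and at least 5, and v_i and v_j when c = 2k - 1.

    Lower bound.  Let A and B be the sets of indices of the outer and inner
    vertices of an independent set.  The offsets 0, 5, 2k, 2k + 5 differ
    pairwise by 5, 2k or 2k - 5 in cyclic distance; as 2k - 5 is odd and is at
    least 5 exactly when k >= 5, each of these is the distance of an mmd pair.
    So the translates of A by these four offsets are disjoint in Z/n,
    4 |A| <= 4k and |A| <= k.  Likewise B is disjoint from its translate by
    2k - 1, so |B| <= 2k.

    Upper bound.  The k vertices u_i with i even and i < 2k, together with the
    2k vertices v_i with i even, are independent: for even c, other than c = 2k
    between two outer vertices, one of the two vertices can move away from the
    other. *)

Set Implicit Arguments.
Unset Strict Implicit.
Unset Printing Implicit Defensive.

(** * Geodesics and strong resolving sets *)

Section Distance.

Variables (T : finType) (e : rel T).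

Lemma gdist_le_path x p : path e x p -> gdist e x (last x p) <= size p.
Proof.
move=> xp; rewrite /gdist; set a := (X in find X _).
have [ltpT | leTp] := ltnP (size p) #|T|; last first.
  by apply: leq_trans leTp; rewrite -[leqRHS](size_iota 0) find_size.
rewrite leqNgt; apply/negP => /(before_find 0).
rewrite nth_iota // add0n => /negbT/negP[].
by rewrite {}/a; apply/existsP; exists (in_tuple p); rewrite /= xp eqxx.
Qed.

Lemma gdist_path x y : connect e x y ->
  exists p, [/\ path e x p, last x p = y & size p = gdist e x y].
Proof.
case/connectP=> q xq ->{y}; case/shortenP: xq => p xp Up _.
set y := last x p; rewrite /gdist; set a := (X in find X _).
have has_a : has a (iota 0 #|T|).
  apply/hasP; exists (size p).
    by rewrite mem_iota /=; have := max_card (mem (x :: p)); rewrite (card_uniqP Up).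
  by rewrite /a; apply/existsP; exists (in_tuple p); rewrite /= xp eqxx.
have := nth_find 0 has_a; rewrite nth_iota; last by rewrite -[ltnRHS](size_iota 0) -has_find.
by rewrite {1}/a => /existsP[r /andP[xr /eqP yr]]; exists r; split; rewrite ?size_tuple.
Qed.

Lemma gdistxx x : gdist e x x = 0.
Proof. by apply/eqP; rewrite -leqn0; apply: (@gdist_le_path x [::]). Qed.

(** Following decreasing edges gives a path to y of length at most f x, and the
    Lipschitz bound excludes a shorter one.  A guessed distance formula, together
    with connectedness, can thus be verified locally, edge by edge. *)
Lemma gdist_potential (f : T -> nat) y :
    f y = 0 -> (forall x z, e x z -> f x <= (f z).+1) ->
    (forall x, x != y -> exists2 z, e x z & f z < f x) ->
  forall x, connect e x y /\ gdist e x y = f x.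
Proof.
move=> fy0 lip desc x.
have [p [xp py szp]] : exists p, [/\ path e x p, last x p = y & size p <= f x].
  have [m lefm] := ubnP (f x); elim: m x lefm => // m IHm x lefm.
  have [-> | /desc[z xz ltzx]] := eqVneq x y; first by exists [::].
  have [|p [zp py szp]] := IHm z; first exact: leq_trans ltzx _.
  by exists (z :: p); rewrite /= xz zp py; split=> //; apply: leq_ltn_trans ltzx.
have xy : connect e x y by apply/connectP; exists p.
split=> //; apply/eqP; rewrite eqn_leq; apply/andP; split.
  by rewrite -py; apply: leq_trans szp; apply: gdist_le_path.
have [q [xq qy <-]] := gdist_path xy.
elim: q x {p xp py szp xy} xq qy => [|z q IHq] x /=; first by move=> _ ->; rewrite fy0.
by case/andP=> xz zq /(IHq _ zq) lefq; apply: leq_trans (lip _ _ xz) _.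
Qed.

Hypotheses (e_sym : symmetric e) (e_conn : forall x y, connect e x y).

Lemma gdist_triangle y x z : gdist e x z <= gdist e x y + gdist e y z.
Proof.
have [p [xp py <-]] := gdist_path (e_conn x y).
have [q [yq qz <-]] := gdist_path (e_conn y z).
rewrite -size_cat -qz -py -last_cat; apply: gdist_le_path.
by rewrite cat_path xp py.
Qed.

Lemma gdist_sym x y : gdist e x y = gdist e y x.
Proof.
wlog suff: x y / gdist e x y <= gdist e y x.
  by move=> le_d; apply/eqP; rewrite eqn_leq !le_d.
have [p [yp px <-]] := gdist_path (e_conn y x).
have := @gdist_le_path x (rev (belast y p)).
rewrite size_rev size_belast -px rev_path.
rewrite (eq_path (e' := e)); last by move=> u v; rewrite e_sym.
have -> : last (last y p) (rev (belast y p)) = y.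
  by case: p {yp px} => //= a p; rewrite rev_cons last_rcons.
exact.
Qed.

Lemma gdist_eq0 x y : (gdist e x y == 0) = (x == y).
Proof.
apply/idP/eqP => [/eqP d0 | ->]; last by rewrite gdistxx.
by have [[|z p] [_ ? /eqP]] := gdist_path (e_conn x y); rewrite ?d0.
Qed.

Lemma gdist_edge x y : e x y -> gdist e x y <= 1.
Proof. by move=> xy; apply: (@gdist_le_path x [:: y]); rewrite /= xy. Qed.

Lemma gdist_step x y : x != y -> exists2 z, e x z & gdist e x y = (gdist e z y).+1.
Proof.
move=> neq_xy; have [[|z p] [/=]] := gdist_path (e_conn x y).
  by move=> _ eq_xy; rewrite eq_xy eqxx in neq_xy.
case/andP=> xz zp py szp; exists z => //.
have := gdist_le_path zp; rewrite py.
by have := gdist_triangle z x y; have := gdist_edge xz; lia.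
Qed.

Lemma on_shortest_pathE z x y :
  on_shortest_path e z x y = (gdist e x z + gdist e z y == gdist e x y).
Proof.
apply/existsP/eqP => [[p /and3P[xp /eqP py zp]] | dxzy].
  apply/eqP; rewrite eqn_leq gdist_triangle andbT.
  have := size_tuple p; case/splitPl: {p}(val p) / zp xp py => p1 p2 p1z.
  rewrite cat_path last_cat size_cat p1z => /andP[xp1 zp2] p2y <-.
  by rewrite leq_add // -?p2y -?p1z gdist_le_path // p1z.
have [p [xp pz szp]] := gdist_path (e_conn x z).
have [q [zq qy szq]] := gdist_path (e_conn z y).
have szpq : size (p ++ q) == gdist e x y by rewrite size_cat szp szq dxzy.
exists (Tuple szpq); rewrite /= cat_path last_cat xp pz zq qy eqxx /=.
by rewrite -cat_cons mem_cat -pz mem_last.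
Qed.

Definition max_distant x y := [forall z, e y z ==> (gdist e x z <= gdist e x y)].
Definition mmd x y := max_distant x y && max_distant y x.

Lemma max_distantP x y :
  reflect (forall z, e y z -> gdist e x z <= gdist e x y) (max_distant x y).
Proof. exact: 'forall_implyP. Qed.

(** If w is beyond x on a geodesic from y and w differs from x, the next vertex
    after x on the way to w is a neighbour of x farther from y. *)
Lemma mmd_resolver w x y : mmd x y -> strongly_resolves e w x y -> w = x \/ w = y.
Proof.
have extend u v : max_distant v u -> on_shortest_path e u v w -> w = u.
  rewrite on_shortest_pathE => /max_distantP maxu /eqP d_vuw.
  apply/eqP; rewrite eq_sym; apply: contraT => /gdist_step[z uz d_uw].
  by have := maxu z uz; have := gdist_triangle z v w; lia.
by case/andP=> maxy maxx /orP[] /extend ->; auto.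
Qed.

(** Among the pairs whose geodesics can be routed through u and then v, one at
    maximal distance is mmd: a neighbour farther away would give a longer
    geodesic that still passes through u and v. *)
Lemma mmd_extension u v : exists x y,
  mmd x y /\ gdist e x u + gdist e u v + gdist e v y = gdist e x y.
Proof.
pose geo (xy : T * T) :=
  gdist e xy.1 u + gdist e u v + gdist e v xy.2 == gdist e xy.1 xy.2.
have geo_uv : geo (u, v) by rewrite /geo /= !gdistxx addn0.
have [[x y] /= /eqP /= d_xy maxd] := arg_maxnP (fun xy => gdist e xy.1 xy.2) geo_uv.
exists x, y; split=> //; apply/andP; split; apply/max_distantP => z yz.
  rewrite leqNgt; apply/negP => lt_d; have /implyP := maxd (x, z).
  have := gdist_edge yz; have := gdist_triangle y v z.
  have := gdist_triangle u x z; have := gdist_triangle v u z.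
  by rewrite /geo /=; lia.
rewrite leqNgt; apply/negP => lt_d; have /implyP := maxd (z, y).
have := gdist_edge yz; have := gdist_triangle x z u; have := gdist_sym z x.
have := gdist_triangle u z y; have := gdist_triangle v u y.
by rewrite /geo /= (gdist_sym y z) (gdist_sym y x) in lt_d *; lia.
Qed.

(** A pair of mmd vertices is resolved only by its own members.  Conversely, if
    u and v lie on a geodesic between mmd vertices x and y, whichever of x and y
    belongs to S resolves u and v. *)
Lemma strong_resolving_setP (S : {set T}) :
  reflect (forall x y, x != y -> mmd x y -> (x \in S) || (y \in S))
          (strong_resolving_set e S).
Proof.
apply: (iffP forallP) => [resS x y neq_xy mmd_xy | coverS u].
  have /existsP[w /andP[Sw]] := implyP (forallP (resS x) y) neq_xy.
  by case/(mmd_resolver mmd_xy) => <-; rewrite Sw ?orbT.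
apply/forallP => v; apply/implyP => neq_uv.
have [x [y [mmd_xy d_xy]]] := mmd_extension u v.
have d_uv : 0 < gdist e u v by rewrite lt0n gdist_eq0.
have neq_xy : x != y by rewrite -gdist_eq0; lia.
apply/existsP; have /orP[Sx | Sy] := coverS x y neq_xy mmd_xy.
  exists x; rewrite Sx /strongly_resolves !on_shortest_pathE.
  rewrite (gdist_sym v u) (gdist_sym u x) (gdist_sym v x).
  by have := gdist_triangle u x v; have := gdist_triangle v x y; lia.
exists y; rewrite Sy /strongly_resolves !on_shortest_pathE.
by have := gdist_triangle v u y; have := gdist_triangle u x y; lia.
Qed.

Lemma sdim_eq (S : {set T}) m :
    strong_resolving_set e S -> #|S| <= m ->
    (forall S', strong_resolving_set e S' -> m <= #|S'|) ->
  sdim e = m.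
Proof.
move=> resS leSm minS; rewrite /sdim.
have resT : strong_resolving_set e [set: T].
  by apply/strong_resolving_setP => x y; rewrite in_setT.
case: arg_minnP => // S0 resS0 minS0; apply/eqP.
by rewrite eqn_leq minS // (leq_trans (minS0 S resS)).
Qed.

End Distance.

(** * Counting in cyclic index sets *)

(** The translates of A by the offsets t i are pairwise disjoint subsets of
    Z/n, each with as many elements as A. *)
Lemma card_packing n (J : finType) (t : J -> nat) (A : {set 'I_n}) :
    (forall a b i j, a \in A -> b \in A -> a + t i = b + t j %[mod n] -> i = j) ->
  #|J| * #|A| <= n.
Proof.
case: n A => [|n] A packA.
  by rewrite [#|A|](_ : _ = 0) ?muln0 //; apply: eq_card0 => -[].
pose sh (ja : J * 'I_n.+1) : 'I_n.+1 := inord ((ja.2 + t ja.1) %% n.+1).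
have sh_inj : {in setX [set: J] A &, injective sh}.
  move=> [i a] [j b]; rewrite !inE /= => Aa Ab /(congr1 val).
  rewrite /= !inordK ?ltn_mod // => eq_ab; have eq_ij := packA _ _ _ _ Aa Ab eq_ab.
  rewrite /= in eq_ij eq_ab; subst j.
  move/eqP: eq_ab; rewrite eqn_modDr !modn_small // => /eqP eq_ab.
  by rewrite (val_inj eq_ab).
rewrite -[#|J|]cardsT -cardsX -(card_in_imset sh_inj).
by rewrite -[leqRHS]card_ord max_card.
Qed.

Lemma card_sumType (A B : finType) (S : {set A + B}) :
  #|S| = #|[set a | inl a \in S]| + #|[set b | inr b \in S]|.
Proof.
rewrite -!sum1_card big_sumType /=.
by congr addn; apply: eq_bigl => a; rewrite inE.
Qed.

(** Distance of the residues i, j < n on a cycle of length n; one of the two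
    truncated differences is 0, so their sum is the absolute difference. *)
Definition cyc (n i j : nat) := minn ((i - j) + (j - i)) (n - ((i - j) + (j - i))).

Lemma eqmod_near n a b : a < 2 * n -> b < 2 * n -> a = b %[mod n] ->
  [\/ a = b, a = b + n | b = a + n].
Proof.
have red m : m < 2 * n -> m = m %% n \/ m = m %% n + n.
  move=> ltm; have [ltmn | lenm] := ltnP m n; first by left; rewrite modn_small.
  right; rewrite -{2}(subnK lenm) modnDr modn_small; lia.
move=> /red[] + /red[] + eq_ab; rewrite -eq_ab; move: (a %% n) => r -> ->;
  by [apply: Or31 | apply: Or32 | apply: Or33].
Qed.

Lemma eqmod_shift n (i j : 'I_n) s : s <= n ->
  (j == i + s %[mod n]) = (j == i + s :> nat) || (j + n == i + s :> nat).
Proof.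
move=> les; have [lti ltj] := (ltn_ord i, ltn_ord j).
apply/eqP/orP => [|[/eqP-> // | /eqP <-]]; last by rewrite modnDr.
by case/eqmod_near; lia.
Qed.

(** * Distances in GP(4k, 2) *)

Section Petersen.

Variable k : nat.
Hypothesis hk : 5 <= k.

Local Notation n := (4 * k).
Local Notation G := (@GP n 2).

(** Inner vertices of the same parity are joined by steps of length 2; each
    change between the rims costs 1, and a parity change needs an outer edge.
    On the outer rim going around directly is better only for small c. *)
Definition gp_dist (x y : 'I_n + 'I_n) : nat :=
  match x, y with
  | inl i, inl j => minn (cyc n i j) (uphalf (cyc n i j) + 2)
  | inl i, inr j | inr i, inl j => uphalf (cyc n i j) + 1
  | inr i, inr j => (cyc n i j)./2 + 3 * odd (cyc n i j)
  end.

Lemma GP_sym : symmetric G.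
Proof. by move=> [i | i] [j | j] //=; rewrite ?[j == i]eq_sym // orbC. Qed.

Lemma GP_shiftE s (i j : 'I_n) : s <= n ->
  (j == i + s %[mod n]) || (i == j + s %[mod n]) =
  [|| j == i + s :> nat, j + n == i + s :> nat, i == j + s :> nat | i + n == j + s :> nat].
Proof. by move=> les; rewrite !eqmod_shift // !orbA. Qed.

Lemma cyc_sym i j : cyc n i j = cyc n j i.
Proof. by rewrite /cyc addnC. Qed.

Lemma cyc_eq0 (i j : 'I_n) : (cyc n i j == 0) = (i == j).
Proof.
have [lti ltj] := (ltn_ord i, ltn_ord j).
by rewrite -val_eqE /= /cyc; lia.
Qed.

Lemma cyc_max i j : cyc n i j <= 2 * k.
Proof. by rewrite /cyc; lia. Qed.

(** As n is even, the lengths of the two ways round have the same parity. *)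
Lemma odd_cyc (i j : 'I_n) : odd (cyc n i j) = odd i (+) odd j.
Proof. by have [lti ltj] := (ltn_ord i, ltn_ord j); rewrite /cyc; lia. Qed.

Lemma cyc_step1 (i j b : 'I_n) :
    (j == i + 1 %[mod n]) || (i == j + 1 %[mod n]) ->
  cyc n i b = (cyc n j b).+1 \/ cyc n j b = (cyc n i b).+1.
Proof.
rewrite GP_shiftE; last lia.
have [[lti ltj] ltb] := (ltn_ord i, ltn_ord j, ltn_ord b).
by rewrite /cyc; lia.
Qed.

(** The third case is a step across the index of b or across its antipode,
    where c is 1 or 2k - 1. *)
Lemma cyc_step2 (i j b : 'I_n) :
    (j == i + 2 %[mod n]) || (i == j + 2 %[mod n]) ->
  [\/ cyc n i b = (cyc n j b).+2, cyc n j b = (cyc n i b).+2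
    | cyc n j b = cyc n i b /\ odd (cyc n i b)].
Proof.
rewrite GP_shiftE => [ij|]; last lia.
suff: cyc n i b = (cyc n j b).+2 \/ cyc n j b = (cyc n i b).+2
      \/ cyc n j b = cyc n i b /\ odd (cyc n i b).
  by case=> [|[]]; [apply: Or31 | apply: Or32 | apply: Or33].
have [[lti ltj] ltb] := (ltn_ord i, ltn_ord j, ltn_ord b).
by move: ij; rewrite /cyc; lia.
Qed.

Lemma GP_lipschitz y x z : G x z -> gp_dist x y <= (gp_dist z y).+1.
Proof.
case: x z y => [i | i] [j | j] [b | b] /=; try (move/eqP <-; lia).
- by case/(cyc_step1 b); lia.
- by case/(cyc_step1 b); lia.
- by case/(cyc_step2 b); lia.
- by case/(cyc_step2 b); lia.
Qed.

Lemma cyc_toward s (i b : 'I_n) : s <= cyc n i b ->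
  exists2 j : 'I_n, (j == i + s %[mod n]) || (i == j + s %[mod n])
                  & cyc n j b = cyc n i b - s.
Proof.
have [lti ltb] := (ltn_ord i, ltn_ord b) => les.
have les_n : s <= n by move: les; rewrite /cyc; lia.
suff [j [ltj adj_ij cyc_j]] : exists j, [/\ j < n,
    [|| j == i + s, j + n == i + s, nat_of_ord i == j + s | i + n == j + s]
    & cyc n j b = cyc n i b - s].
  by exists (Ordinal ltj) => //; rewrite GP_shiftE.
(* fwd: the shorter way from i to b goes in the direction of increasing indices *)
have [fwd | bwd] := boolP ((i <= b <= i + 2 * k) || (b + 2 * k <= i)).
  have [wrap | nowrap] := leqP n (i + s).
    by exists (i + s - n); split; move: les; rewrite /cyc; lia.
  by exists (i + s); split; move: les; rewrite /cyc; lia.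
have [wrap | nowrap] := ltnP i s.
  by exists (i + n - s); split; move: les; rewrite /cyc; lia.
by exists (i - s); split; move: les; rewrite /cyc; lia.
Qed.

(** Moving away from i is moving towards the antipode of i, since the cyclic
    distances of a point to i and to its antipode add up to 2k. *)
Lemma cyc_away s (i j : 'I_n) : cyc n i j + s <= 2 * k ->
  exists2 l : 'I_n, (l == j + s %[mod n]) || (j == l + s %[mod n])
                  & cyc n i l = cyc n i j + s.
Proof.
move=> le_s; have lti := ltn_ord i.
(* b is the antipode of i *)
have [b cyc_b] : exists b : 'I_n, forall l : 'I_n, cyc n l b = 2 * k - cyc n i l.
  have [lti2 | le2i] := ltnP i (2 * k).
    have ltb : i + 2 * k < n by lia.
    by exists (Ordinal ltb) => l; have := ltn_ord l; rewrite /cyc /=; lia.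
  have ltb : i - 2 * k < n by lia.
  by exists (Ordinal ltb) => l; have := ltn_ord l; rewrite /cyc /=; lia.
have [|l jl] := @cyc_toward s j b; first by rewrite cyc_b; lia.
rewrite !cyc_b => c_l; exists l => //.
by move: (cyc n i l) (cyc n i j) (cyc_max i l) le_s c_l => {jl cyc_b} c' c; lia.
Qed.

(** Towards an outer vertex, stay on the outer rim as long as the direct way is
    shortest, and otherwise use the inner rim until c <= 1.  Towards an inner
    vertex, correct the parity on the outer rim first, then step by 2. *)
Lemma GP_descent y x : x != y -> exists2 z, G x z & gp_dist z y < gp_dist x y.
Proof.
case: x y => [i | i] [b | b] neq_xy.
- have {neq_xy} c_gt0 : 0 < cyc n i b by rewrite lt0n cyc_eq0.
  have [le_c | lt_c] := leqP (cyc n i b) (uphalf (cyc n i b) + 2).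
    have [j ij c_j] := cyc_toward c_gt0; exists (inl j); rewrite //= c_j.
    by move: (cyc n i b) c_gt0 le_c {ij c_j} => c; lia.
  by exists (inr i); rewrite //=; move: (cyc n i b) lt_c {c_gt0} => c; lia.
- have [odd_c | even_c] := boolP (odd (cyc n i b)).
    have c_gt0 : 0 < cyc n i b by rewrite odd_gt0.
    have [j ij c_j] := cyc_toward c_gt0; exists (inl j); rewrite //= c_j.
    by move: (cyc n i b) c_gt0 odd_c {ij c_j} => c; lia.
  by exists (inr i); rewrite //=; move: (cyc n i b) even_c => c; lia.
- have [c_gt1 | c_le1] := ltnP 1 (cyc n i b).
    have [j ij c_j] := cyc_toward c_gt1; exists (inr j); rewrite //= c_j.
    by move: (cyc n i b) c_gt1 {ij c_j} => c; lia.
  by exists (inl i); rewrite //=; move: (cyc n i b) c_le1 => c; lia.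
- have {neq_xy} c_gt0 : 0 < cyc n i b by rewrite lt0n cyc_eq0.
  have [odd_c | even_c] := boolP (odd (cyc n i b)).
    by exists (inl i); rewrite //=; move: (cyc n i b) odd_c {c_gt0} => c; lia.
  have c_gt1 : 1 < cyc n i b by move: (cyc n i b) c_gt0 even_c => c; lia.
  have [j ij c_j] := cyc_toward c_gt1; exists (inr j); rewrite //= c_j.
  by move: (cyc n i b) c_gt1 even_c {c_gt0 ij c_j} => c; lia.
Qed.

Lemma gp_distE x y : connect G x y /\ gdist G x y = gp_dist x y.
Proof.
apply: (gdist_potential (f := gp_dist^~ y)); last exact: GP_descent.
- by case: y => b /=; have /eqP -> : cyc n b b == 0 by rewrite cyc_eq0.
- exact: GP_lipschitz.
Qed.

Lemma GP_conn x y : connect G x y. Proof. by have [] := gp_distE x y. Qed.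

Lemma GP_gdist x y : gdist G x y = gp_dist x y.
Proof. by have [] := gp_distE x y. Qed.

(** * Mutually maximally distant pairs *)

(** For odd c >= 5 the distance uphalf c + 2 is unchanged when c grows by 1 and
    not larger when c drops by 1; for c = 2k it is the maximum. *)
Lemma GP_mmd_outer (i j : 'I_n) :
  (odd (cyc n i j) && (5 <= cyc n i j)) || (cyc n i j == 2 * k) ->
  mmd G (inl i) (inl j).
Proof.
have half (a b : 'I_n) :
    (odd (cyc n a b) && (5 <= cyc n a b)) || (cyc n a b == 2 * k) ->
  max_distant G (inl a) (inl b).
  move=> far; apply/max_distantP => -[l | l] /=; rewrite !GP_gdist /=.
    rewrite (cyc_sym a b) (cyc_sym a l) in far *.
    by have := cyc_max l a; move=> le_c /(cyc_step1 a)[]; lia.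
  by move/eqP <-; move: (cyc n a b) far => c; lia.
by move=> far; rewrite /mmd !half // cyc_sym.
Qed.

(** For c = 2k - 1 the distance is k + 2, the largest one between inner vertices
    with c odd, and steps on the inner rim keep c odd; the spoke to the outer rim
    leads to distance k + 1. *)
Lemma GP_mmd_inner (i j : 'I_n) :
  cyc n i j = 2 * k - 1 -> mmd G (inr i) (inr j).
Proof.
have half (a b : 'I_n) :
    cyc n a b = 2 * k - 1 -> max_distant G (inr a) (inr b).
  move=> far; apply/max_distantP => -[l | l] /=; rewrite !GP_gdist /=.
    by move/eqP <-; rewrite far; lia.
  rewrite (cyc_sym a b) (cyc_sym a l) in far *.
  by have := cyc_max l a; move=> le_c /(cyc_step2 a)[]; lia.
by move=> far; rewrite /mmd !half // cyc_sym.
Qed.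

Lemma GP_not_mmd x y z : G y z -> gp_dist x y < gp_dist x z -> ~~ mmd G x y.
Proof.
move=> yz lt_d; apply/negP => /andP[/max_distantP/(_ z yz) + _].
by rewrite !GP_gdist leqNgt lt_d.
Qed.

Lemma GP_not_mmd_outer (i j : 'I_n) :
  ~~ odd (cyc n i j) -> cyc n i j < 2 * k -> i != j -> ~~ mmd G (inl i) (inl j).
Proof.
move=> even_c lt_c neq_ij; have [|l jl c_l] := @cyc_away 1 i j; first by lia.
apply: (@GP_not_mmd _ _ (inl l)); rewrite //= c_l.
by move: neq_ij; rewrite -cyc_eq0; move: (cyc n i j) even_c {lt_c c_l jl} => c; lia.
Qed.

Lemma GP_not_mmd_inner (i j : 'I_n) :
  ~~ odd (cyc n i j) -> ~~ mmd G (inr i) (inr j).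
Proof.
move=> even_c; apply: (@GP_not_mmd _ _ (inl j)); rewrite //=.
by move: (cyc n i j) even_c => c; lia.
Qed.

Lemma GP_not_mmd_mixed (i j : 'I_n) :
  ~~ odd (cyc n i j) -> ~~ mmd G (inl i) (inr j).
Proof.
move=> even_c; have [lt_c | ge_c] := ltnP (cyc n i j) (2 * k).
  have [|l jl c_l] := @cyc_away 2 i j; first by lia.
  apply: (@GP_not_mmd _ _ (inr l)); rewrite //= c_l.
  by move: (cyc n i j) {even_c lt_c jl c_l} => c; lia.
(* v_j is antipodal to u_i here, and its spoke leads to u_j, which is farther. *)
apply: (@GP_not_mmd _ _ (inl j)); rewrite //=.
by move: (cyc n i j) even_c ge_c => c; lia.
Qed.

(** * The two bounds *)

(** The offsets are 5 p + 2k q for bits p, q on the outer rim and (2k - 1) p on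
    the inner rim: any two of them differ by the distance of an mmd pair. *)
Lemma GP_strong_resolving_card (S : {set 'I_n + 'I_n}) :
  strong_resolving_set G S -> 5 * k <= #|S|.
Proof.
move/(strong_resolving_setP GP_sym GP_conn) => coverS.
pose A := [set i | inl i \notin S]; pose B := [set i | inr i \notin S].
have leA : #|{: bool * bool}| * #|A| <= n.
  apply: (@card_packing n _ (fun p : bool * bool => p.1 * 5 + p.2 * (2 * k))) => a b p q.
  have [lta ltb] := (ltn_ord a, ltn_ord b).
  rewrite !inE => /negP Aa /negP Ab ab; apply/eqP; apply: contraT => neq_pq.
  suff far : (odd (cyc n a b) && (5 <= cyc n a b)) || (cyc n a b == 2 * k).
    have neq_ab : inl a != inl b :> 'I_n + 'I_n.
      by rewrite (inj_eq inl_inj) -cyc_eq0; move: (cyc n a b) far {ab} => c; lia.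
    by have /orP[] := coverS _ _ neq_ab (GP_mmd_outer far).
  case: p q neq_pq ab => [[] []] [[] []] //= _ /eqmod_near[]; rewrite /cyc; lia.
have leB : #|{: bool}| * #|B| <= n.
  apply: (@card_packing n _ (fun p : bool => p * (2 * k - 1))) => a b p q.
  have [lta ltb] := (ltn_ord a, ltn_ord b).
  rewrite !inE => /negP Ba /negP Bb ab; apply/eqP; apply: contraT => neq_pq.
  suff far : cyc n a b = 2 * k - 1.
    have neq_ab : inr a != inr b :> 'I_n + 'I_n.
      by rewrite (inj_eq inr_inj) -cyc_eq0 far; lia.
    by have /orP[] := coverS _ _ neq_ab (GP_mmd_inner far).
  by case: p q neq_pq ab => [] [] //= _ /eqmod_near[]; rewrite /cyc; lia.
have cardC : #|~: S| = #|A| + #|B|.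
  by rewrite card_sumType; congr (_ + _); apply: eq_card => i; rewrite !inE.
rewrite card_prod !card_bool in leA leB.
by have := cardsC S; rewrite card_sum !card_ord cardC; lia.
Qed.

Definition gp_basis : {set 'I_n + 'I_n} :=
  [set x : 'I_n + 'I_n | match x with inl i => odd i || (2 * k <= i) | inr i => odd i end].

Lemma gp_basis_resolving : strong_resolving_set G gp_basis.
Proof.
apply/(strong_resolving_setP GP_sym GP_conn) => x y neq_xy; apply: contraLR.
rewrite negb_or !inE; case: x y neq_xy => [i | i] [j | j] neq_xy.
- rewrite !negb_or -!ltnNge => /andP[/andP[ei lti] /andP[ej ltj]].
  apply: GP_not_mmd_outer; rewrite ?odd_cyc ?(negPf ei) ?(negPf ej) //.
  by rewrite /cyc; lia.
- rewrite negb_or => /andP[/andP[ei _] ej].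
  by apply: GP_not_mmd_mixed; rewrite odd_cyc (negPf ei) (negPf ej).
- rewrite negb_or => /andP[ei /andP[ej _]]; rewrite /mmd andbC.
  by apply: GP_not_mmd_mixed; rewrite odd_cyc (negPf ei) (negPf ej).
- by case/andP=> ei ej; apply: GP_not_mmd_inner; rewrite odd_cyc (negPf ei) (negPf ej).
Qed.

(** Doubling indices on each rim embeds a set of k + 2k elements into the
    complement. *)
Lemma card_gp_basis : #|gp_basis| <= 5 * k.
Proof.
have lt_dbl m (i : 'I_m) : m <= 2 * k -> i.*2 < n by have := ltn_ord i; lia.
have le_k : k <= 2 * k by lia.
pose f (x : 'I_k + 'I_(2 * k)) : 'I_n + 'I_n := match x with
  | inl i => inl (Ordinal (lt_dbl _ i le_k))
  | inr i => inr (Ordinal (lt_dbl _ i (leqnn _))) end.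
have f_inj : injective f.
  by move=> [i | i] [j | j] //= [/double_inj/val_inj ->].
have: f @: setT \subset ~: gp_basis.
  apply/subsetP => _ /imsetP[[i | i] _ ->]; rewrite !inE /= odd_double //=.
  by have := ltn_ord i; lia.
move/subset_leq_card; rewrite card_imset // cardsT card_sum !card_ord.
rewrite -(leq_add2l (5 * k)) => le_c; rewrite -(leq_add2r #|~: gp_basis|) cardsC.
by rewrite (leq_trans _ le_c) // card_sum !card_ord; lia.
Qed.

End Petersen.

Unset Implicit Arguments.

Theorem theorem2 (k : nat) (hk : 5 <= k) : sdim (@GP (4 * k) 2) = 5 * k.
Proof.
exact: (sdim_eq (@GP_sym k) (GP_conn hk) (gp_basis_resolving hk)
  (card_gp_basis hk) (@GP_strong_resolving_card k hk)).
Qed.
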